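(* Let $S$ be an infinite set and let $A\in(\mathbb{R}\cup\{-\infty\})^{S\times S}$ be such that $\rho(A)\in\mathbb{R}$. Assume that $\tilde A$ has Property (T). Let $\mathscr{T}$ be the semimodule of all $\tilde A^*$-tight vectors $u\in(\mathbb{R}\cup\{-\infty\})^S$ satisfying $(Au)_i=\rho(A)+u_i$ for all $i\in S$. Then the extremal generators of $\mathscr{T}$ are precisely the vectors of the form $\alpha+\tilde A^*_{\cdot j}=(\alpha+\tilde A^*_{ij})_{i\in S}$, where $\alpha\in\mathbb{R}$ and $j$ is a critical node of $A$. Moreover, a minimal spanning family of $\mathscr{T}$ is obtained by taking exactly one column $\tilde A^*_{\cdot j}$ from each critical class of $A$ (i.e. by choosing exactly one node $j$ in each critical class and taking the corresponding columns).
   Context: Write $\overline{\mathbb{R}}=\mathbb{R}\cup\{-\infty,+\infty\}$ and $\mathbb{R}_{\max}=\mathbb{R}\cup\{-\infty\}$, with the convention $(-\infty)+(+\infty)=-\infty$; the supremum of the empty set is $-\infty$. For $B,C\in\overline{\mathbb{R}}^{S\times S}$ and $u\in\overline{\mathbb{R}}^S$, $(BC)_{ij}=\sup_{k\in S}(B_{ik}+C_{kj})$ and $(Bu)_i=\sup_{k\in S}(B_{ik}+u_k)$; $B^0=I$ is the matrix with $0$ on the diagonal and $-\infty$ elsewhere, $B^n$ is the $n$-th power, $B^*_{ij}:=\sup_{n\ge0}(B^n)_{ij}$, and $B_{\cdot j}$ is the $j$-th column. $G(A)$ is the digraph with node set $S$ and an arc $i\to j$ whenever $A_{ij}\ne-\infty$.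 A path $p=(i_0,\dots,i_n)$ in $G(A)$ has length $|p|=n$ and weight $|p|_A=\sum_{t=0}^{n-1}A_{i_ti_{t+1}}$; a circuit is a path of length $\ge1$ with $i_0=i_n$. The maximal circuit mean is $\rho(A):=\sup_{c}|c|_A/|c|$ over all circuits $c$ of $G(A)$. When $\rho(A)\in\mathbb{R}$, $\tilde A_{ij}:=A_{ij}-\rho(A)$. The critical graph is the subgraph of $G(A)$ which is the union (nodes and arcs) of all circuits $c$ with $|c|_A/|c|=\rho(A)$; its nodes are the critical nodes, and the set of nodes of a strongly connected component of the critical graph is a critical class. A map $v:S\to\overline{\mathbb{R}}$ is tight if $v_j\neq+\infty$ for all $j$ and $\{j\in S: v_j\ge\beta\}$ is finite for every $\beta\in\mathbb{R}$. A vector $u\in\overline{\mathbb{R}}^S$ is $B$-tight if for each $i\in S$ the map $j\mapsto B_{ij}+u_j$ is tight. A matrix $B$ has Property (T) if all columns of $B^*$ are $B^*$-tight, i.e. for all $i,j\in S$ the map $k\mapsto B^*_{ik}+B^*_{kj}$ is tight. Let $V\subset\mathbb{R}_{\max}^S$ be a subsemimodule (stable under finite max-plus linear combinations). An element $\xi\in V$, not identically $-\infty$, is an extremal generator of $V$ if $\xi=\max(u,v)$ (entrywise) with $u,v\in V$ implies $\xi=u$ or $\xi=v$. $V$ is spanned by a family $\{\xi^k\}_{k\in K}\subset V$ if every $v\in V$ can be written as $v_i=\sup_{k\in K}(\nu_k+\xi^k_i)$ for all $i\in S$, with $\nu_k\in\mathbb{R}_{\max}$ ($K$ possibly infinite).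 A spanning family is minimal if it does not include any smaller (i.e. proper sub-) spanning family of $V$. *)

(* Defs.v *)
From HB Require Import structures.
From mathcomp Require Import all_boot all_order all_algebra.
From mathcomp Require Import all_classical all_reals all_analysis.

Set Implicit Arguments.
Unset Strict Implicit.
Unset Printing Implicit Defensive.

Import Order.TTheory GRing.Theory Num.Theory.

Local Open Scope classical_set_scope.
Local Open Scope ring_scope.
Local Open Scope ereal_scope.

(** Max-plus matrices and vectors are plain functions into [\bar R].  The
    library already has the conventions needed here: [-oo + +oo = -oo] and
    [ereal_sup set0 = -oo].  Membership in R_max is expressed by [_ != +oo]. *)

Section MaxPlus.
Context {R : realType} {S : choiceType}.
Implicit Types (A B C : S -> S -> \bar R) (u v : S -> \bar R).

Definition mp_id : S -> S -> \bar R := fun i j => if i == j then 0 else -oo.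

Definition mp_mul B C : S -> S -> \bar R :=
  fun i j => ereal_sup [set B i k + C k j | k in [set: S]].

Definition mp_act B u : S -> \bar R :=
  fun i => ereal_sup [set B i k + u k | k in [set: S]].

Definition mp_pow B (n : nat) : S -> S -> \bar R := iter n (mp_mul B) mp_id.

Definition mp_star B : S -> S -> \bar R :=
  fun i j => ereal_sup [set mp_pow B n i j | n in [set: nat]].

Definition arc A : rel S := fun i j => A i j != -oo.

(** A path [(i_0, ..., i_n)] is represented, as in the library, by its origin
    [x = i_0] and the sequence [p = [:: i_1; ...; i_n]]; its length is
    [size p]. *)
Definition weight A (x : S) (p : seq S) : \bar R :=
  \sum_(a <- pairmap A x p) a.

Definition circuit A (x : S) (p : seq S) : Prop :=
  [/\ path (arc A) x p, (0 < size p)%N & last x p = x].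

Definition mean_weight A (x : S) (p : seq S) : \bar R :=
  weight A x p * ((size p)%:R^-1)%:E.

Definition max_circuit_mean A : \bar R :=
  ereal_sup [set m | exists x p, circuit A x p /\ m = mean_weight A x p].

Definition normalized A : S -> S -> \bar R :=
  fun i j => A i j - max_circuit_mean A.

Definition critical_circuit A (x : S) (p : seq S) : Prop :=
  circuit A x p /\ mean_weight A x p = max_circuit_mean A.

Definition critical_node A (i : S) : Prop :=
  exists x p, critical_circuit A x p /\ i \in x :: p.

Definition critical_arc A (i j : S) : Prop :=
  exists x p, critical_circuit A x p /\ (i, j) \in zip (x :: p) p.

Definition critical_reach A (i j : S) : Prop :=
  exists p, path (fun k l => `[< critical_arc A k l >]) i p /\ last i p = j.

(** The sets of nodes of the strongly connected components of the critical
    graph. *)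
Definition critical_class A (C : set S) : Prop :=
  exists i, critical_node A i /\
    C = [set j | critical_node A j /\
                 critical_reach A i j /\ critical_reach A j i].

Definition tight v : Prop :=
  (forall j, v j != +oo) /\
  forall beta : R, finite_set [set j | beta%:E <= v j].

Definition mx_tight B u : Prop := forall i, tight (fun j => B i j + u j).

Definition propertyT B : Prop :=
  forall j, mx_tight (mp_star B) (fun k => mp_star B k j).

Definition tight_eigenvectors A : set (S -> \bar R) :=
  [set u | [/\ forall i, u i != +oo,
               mx_tight (mp_star (normalized A)) u
             & forall i, mp_act A u i = max_circuit_mean A + u i]].

Definition subsemimodule (V : set (S -> \bar R)) : Prop :=
  [/\ forall u, V u -> forall i, u i != +oo,
      V (fun=> -oo)
    & forall (a b : \bar R) u v, a != +oo -> b != +oo -> V u -> V v ->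
        V (fun i => maxe (a + u i) (b + v i))].

Definition extremal_generator (V : set (S -> \bar R)) (xi : S -> \bar R) : Prop :=
  [/\ V xi, exists i, xi i != -oo
    & forall u v, V u -> V v -> xi = (fun i => maxe (u i) (v i)) ->
        xi = u \/ xi = v].

(** Families are indexed by a set [J] of indices in a type [K], so that a
    subfamily is given by a subset of [J]. *)
Definition spanning_family (V : set (S -> \bar R)) {K : Type} (J : set K)
    (xi : K -> S -> \bar R) : Prop :=
  (forall k, J k -> V (xi k)) /\
  forall v, V v -> exists nu : K -> \bar R,
    (forall k, J k -> nu k != +oo) /\
    forall i, v i = ereal_sup [set nu k + xi k i | k in J].

Definition minimal_spanning_family (V : set (S -> \bar R)) {K : Type}
    (J : set K) (xi : K -> S -> \bar R) : Prop :=
  spanning_family V J xi /\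
  forall J', J' `<` J -> ~ spanning_family V J' xi.

Definition critical_transversal A (J : set S) : Prop :=
  J `<=` critical_node A /\
  forall C : set S, critical_class A C -> exists! j, C j /\ J j.

Lemma mp_act_lin B (a b : \bar R) u v : a != +oo -> b != +oo ->
  (forall i, u i != +oo) -> (forall i, v i != +oo) ->
  mp_act B (fun i => maxe (a + u i) (b + v i)) =
  fun i => maxe (a + mp_act B u i) (b + mp_act B v i).
Proof.
move=> aoo boo uoo voo; apply/funext => i.
have supD (c : \bar R) w : c != +oo ->
    c + mp_act B w i = ereal_sup [set B i k + (c + w k) | k in [set: S]].
  case: c => [c| |] // _; last first.
    by apply/esym/ereal_sup_ninfty => _ [k _ <-] /=; rewrite addNye addeNy.
  apply/eqP; rewrite eq_le; apply/andP; split; last first.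
    apply: ge_ereal_sup => _ [k _ <-]; rewrite addeCA leeD2lE//.
    by apply: ereal_sup_ubound; exists k.
  rewrite addeC -leeBrDr//; apply: ge_ereal_sup => _ [k _ <-].
  rewrite leeBrDr// addeC addeCA.
  by apply: ereal_sup_ubound; exists k.
rewrite !supD//; apply/eqP; rewrite eq_le; apply/andP; split.
  apply: ge_ereal_sup => _ [k _ <-]; rewrite adde_maxr.
  by rewrite ge_max !le_max; apply/andP; split; apply/orP; [left|right];
    apply: ereal_sup_ubound; exists k.
rewrite ge_max; apply/andP; split; apply: ge_ereal_sup => _ [k _ <-];
  (apply: le_trans; last by apply: ereal_sup_ubound; exists k => //);
  by rewrite leeD2l// le_max lexx ?orbT.
Qed.

Lemma tightD (a : \bar R) v : a != +oo -> tight v -> tight (fun j => a + v j).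
Proof.
case: a => [a| |] // _ [voo vfin]; split=> [j|beta].
- by case: (v j) (voo j).
- apply: sub_finite_set (vfin (beta - a)%R) => j /=.
  by rewrite EFinB leeBlDr// addeC.
- by rewrite addNye.
- apply: sub_finite_set (finite_set0 S) => j /=.
  by rewrite addNye leeNy_eq.
Qed.

Lemma tight_max u v : tight u -> tight v -> tight (fun j => maxe (u j) (v j)).
Proof.
move=> [uoo ufin] [voo vfin]; split=> [j|beta].
  by rewrite /maxe; case: ifP.
have fin : finite_set ([set j | beta%:E <= u j] `|` [set j | beta%:E <= v j]).
  by rewrite finite_setU.
apply: sub_finite_set fin => j /=.
by rewrite le_max => /orP[]; [left|right].
Qed.

Lemma tight_eigenvectors_subsemimodule A :
  subsemimodule (tight_eigenvectors A).
Proof.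
split.
- by move=> u [].
- split=> // [i|i].
    split=> [j|beta]; first by rewrite addeNy.
    by apply: sub_finite_set (finite_set0 S) => j /=; rewrite addeNy leeNy_eq.
  by rewrite addeNy; apply/ereal_sup_ninfty => _ [k _ <-] /=; rewrite addeNy.
- move=> a b u v aoo boo [uoo ut ue] [voo vt ve]; split.
  + move=> i; rewrite /maxe; case: ifP => _.
      by case: b boo => //; case: (v i) (voo i).
    by case: a aoo => //; case: (u i) (uoo i).
  + move=> i; have := tight_max (tightD aoo (ut i)) (tightD boo (vt i)).
    by congr tight; apply/funext => j; rewrite adde_maxr; congr maxe;
      rewrite addeCA.
  + by move=> i; rewrite mp_act_lin// ue ve adde_maxr; congr maxe;
      rewrite addeCA.
Qed.

End MaxPlus.

(* Main.v *)
Require Import Defs.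
From mathcomp Require Import all_boot all_order all_algebra.
From mathcomp Require Import all_classical all_reals all_analysis.

Set Implicit Arguments.
Unset Strict Implicit.
Unset Printing Implicit Defensive.

Local Open Scope classical_set_scope.
Local Open Scope ereal_scope.

Import Order.TTheory GRing.Theory Num.Theory.

(** Let [B] be the normalized matrix and [M = B^*]. An eigenvector [u] is a fixed
    point of [B], and tightness turns every supremum [u i = sup_k (B i k + u k)]
    into a maximum. Following maximizing arcs from [i] one stays in a finite
    set, hence closes a circuit of weight zero, so [u i = M i x + u x] for some
    critical node [x]: the critical columns of [M] span. A critical column
    [M _ j] is extremal because any fixed point [v] satisfies
    [M i j + v j <= v i]. Conversely, for an extremal [u], finitely many
    critical nodes [j] attain [u i0]; deleting these terms one at a time from
    the decomposition of [u] must fail to preserve [u] at some step, and there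
    [u] is a multiple of a column. Finally [M i j + M j i = 0] holds between
    critical nodes exactly when they lie in the same class, since finite
    entries of [M] are attained by paths; then their columns are proportional,
    and otherwise neither can replace the other. *)

(** * Tight maps and suprema in the extended reals *)

Section ExtendedReals.
Context {R : realType}.
Implicit Types (a b c s : \bar R).

Lemma adde_neqy a b : a != +oo -> b != +oo -> a + b != +oo.
Proof. by case: a => [a| |] //; case: b => [b| |]. Qed.

Lemma ereal_sup_addr_le (E : set (\bar R)) c d : c != +oo ->
  (forall x, E x -> x + c <= d) -> ereal_sup E + c <= d.
Proof.
case: c => [c| |] // _ Ed; last by rewrite addeNy leNye.
rewrite -leeBrDr//; apply: ge_ereal_sup => x Ex.
by rewrite leeBrDr//; exact: Ed.
Qed.

Lemma ereal_sup_addl_le (E : set (\bar R)) c d : c != +oo ->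
  (forall x, E x -> c + x <= d) -> c + ereal_sup E <= d.
Proof.
move=> coo Ed; rewrite addeC; apply: ereal_sup_addr_le => // x Ex.
by rewrite addeC; exact: Ed.
Qed.

Lemma le_ereal_sup_image {T : Type} (D : set T) (f : T -> \bar R) k :
  D k -> f k <= ereal_sup [set f l | l in D].
Proof. by move=> Dk; apply: ereal_sup_ubound; exists k. Qed.

Lemma ge_ereal_sup_image {T : Type} (D : set T) (f : T -> \bar R) c :
  (forall k, D k -> f k <= c) -> ereal_sup [set f l | l in D] <= c.
Proof. by move=> fc; apply: ge_ereal_sup => _ [k Dk <-]; exact: fc. Qed.

Lemma finite_uniform_gap {T : choiceType} (F : set T) (P : T -> R -> Prop) :
  finite_set F ->
  (forall k e e', (e' <= e)%R -> P k e -> P k e') ->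
  (forall k, F k -> exists2 e, (0 < e)%R & P k e) ->
  exists2 e, (0 < e)%R & forall k, F k -> P k e.
Proof.
move=> /finite_seqP[r ->] Ple; elim: r => [|x r IH] Pr.
  by exists 1%R => // k.
have [y Fy|e e0 re] := IH; first by apply: Pr; rewrite /= inE Fy orbT.
have [|e' e'0 xe'] := Pr x; first by rewrite /= mem_head.
exists (Num.min e e'); first by rewrite lt_min e0.
move=> k /=; rewrite inE => /orP[/eqP ->|kr].
  by apply: Ple xe'; rewrite ge_min lexx orbT.
by apply: Ple (re k kr); rewrite ge_min lexx.
Qed.

Lemma tight_le {S : choiceType} (u v : S -> \bar R) :
  (forall j, u j <= v j) -> tight v -> tight u.
Proof.
move=> uv [voo vfin]; split=> [j|beta].
  by move: (uv j) (voo j); case: (v j) => [r| |] //; case: (u j).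
by apply: sub_finite_set (vfin beta) => j /= /le_trans; apply.
Qed.

(** Only finitely many values reach [s - 1], so the least of their gaps, capped at [1], serves for
    all of [D]. *)
Lemma tight_gap {S : choiceType} (v : S -> \bar R) (D : set S) (s : R) :
  tight v -> (forall k, D k -> v k < s%:E) ->
  exists2 e : R, (0 < e)%R & forall k, D k -> v k <= (s - e)%:E.
Proof.
move=> [voo vfin] vs.
have [||e e0 He] := @finite_uniform_gap S
  [set k | (s - 1)%:E <= v k] (fun k e => D k -> v k <= (s - e)%:E) (vfin _).
- by move=> k e e' ee' H /H /le_trans; apply; rewrite lee_fin lerB.
- move=> k _; have [Dk|nDk] := pselect (D k); last by exists 1%R.
  move: (vs k Dk) => {vs}; case: (v k) => [r| |] // rs.
    exists (s - r)%R; first by rewrite subr_gt0.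
    by move=> _; rewrite lee_fin opprB addrCA subrr addr0.
  by exists 1%R => // _; rewrite leNye.
exists (Num.min e 1)%R; first by rewrite lt_min e0 /=.
move=> k Dk; have [s1v|vs1] := leP (s - 1)%:E (v k).
  by apply: le_trans (He k s1v Dk) _; rewrite lee_fin lerB// ge_min lexx.
by apply: le_trans (ltW vs1) _; rewrite lee_fin lerB// ge_min lexx orbT.
Qed.

(** If every value on [D] were below [s], a uniform gap would hold the supremum to [s - e]. This is
    how suprema become maxima. *)
Lemma tight_sup_attained {S : choiceType} (v : S -> \bar R) (D : set S) s :
  tight v -> s \is a fin_num -> s <= ereal_sup [set v k | k in D] ->
  exists2 k, D k & s <= v k.
Proof.
move=> tv; case: s => [s| |] // _ sle.
apply: contrapT => H.
have [k Dk|e e0 He] := @tight_gap S v D s tv.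
  by rewrite ltNge; apply/negP => sk; apply: H; exists k.
have := le_trans sle (ge_ereal_sup_image He).
by rewrite lee_fin lerBrDr gerDl leNgt e0.
Qed.

End ExtendedReals.

(** * Weights and arcs of paths *)

Section PathWeights.
Context {R : realType} {S : choiceType}.
Implicit Types (A B : S -> S -> \bar R) (u : S -> \bar R).

Lemma weight_nil B x : weight B x [::] = 0.
Proof. by rewrite /weight big_nil. Qed.

Lemma weight_cons B x y p : weight B x (y :: p) = B x y + weight B y p.
Proof. by rewrite /weight big_cons. Qed.

Lemma weight_cat B x p q :
  weight B x (p ++ q) = weight B x p + weight B (last x p) q.
Proof.
elim: p x => [|y p IH] x /=; first by rewrite weight_nil add0e.
by rewrite !weight_cons IH addeA.
Qed.

Lemma zip_path_cat (x : S) p q :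
  zip (x :: p ++ q) (p ++ q) = zip (x :: p) p ++ zip (last x p :: q) q.
Proof. by elim: p x => [|y p IH] x //=; rewrite IH. Qed.

Lemma path_zip (e : rel S) x p :
  (forall a, a \in zip (x :: p) p -> e a.1 a.2) -> path e x p.
Proof.
elim: p x => [//|y p IH] x H /=; apply/andP; split.
  by apply: (H (x, y)); rewrite /= mem_head.
by apply: IH => a ap; apply: H; rewrite /= inE ap orbT.
Qed.

Lemma circuit_out_arc (x : S) p j : (0 < size p)%N -> last x p = x ->
  j \in x :: p -> exists l, (j, l) \in zip (x :: p) p.
Proof.
move=> p0 lx jp.
have : j = last x p \/ exists l, (j, l) \in zip (x :: p) p.
  elim: p x {p0 lx} jp => [|y p IH] x /=.
    by rewrite inE => /eqP ->; left.
  rewrite inE => /orP[/eqP ->|/IH[->|[l jl]]].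
  - by right; exists y; rewrite mem_head.
  - by left.
  - by right; exists l; rewrite inE jl orbT.
case=> // ->; rewrite lx; case: p p0 {lx jp} => // y p _.
by exists y; rewrite /= mem_head.
Qed.

(** When [u] is a fixed point of [B], these are the maximizing arcs; along them the weight
    telescopes against [u]. *)
Definition saturated B u : rel S := fun k l => B k l + u l == u k.

Lemma weight_saturated B u x p :
  path (saturated B u) x p -> weight B x p + u (last x p) = u x.
Proof.
elim: p x => [|y p IH] x /=; first by rewrite weight_nil add0e.
by move=> /andP[/eqP xy /IH yp]; rewrite weight_cons -addeA yp.
Qed.

Lemma path_saturated_arc B u x p :
  path (saturated B u) x p -> u x != -oo -> path (Defs.arc B) x p.
Proof.
elim: p x => [//|y p IH] x /= /andP[/eqP xy yp] ux.
rewrite /Defs.arc; move: ux; rewrite -xy.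
case: (B x y) => [b| |] //= ux; (apply: IH => //; move: ux;
  by case: (u y)).
Qed.

End PathWeights.

(** * Inequalities for the star *)

Section Star.
Context {R : realType} {S : choiceType} {B : S -> S -> \bar R}.
Context (Boo : forall i j, B i j != +oo).

Lemma mp_act_le u c i : (forall k, B i k + u k <= c) -> mp_act B u i <= c.
Proof. by move=> H; apply: ge_ereal_sup_image => k _; exact: H. Qed.

Lemma le_mp_act u i k : B i k + u k <= mp_act B u i.
Proof. by apply: (@le_ereal_sup_image _ _ _ (fun k => B i k + u k)). Qed.

Lemma mp_pow_star n i j : mp_pow B n i j <= mp_star B i j.
Proof. by apply: (@le_ereal_sup_image _ _ _ (fun n => mp_pow B n i j)). Qed.

Lemma mp_mul_pow n i k j : B i k + mp_pow B n k j <= mp_pow B n.+1 i j.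
Proof. by apply: (@le_ereal_sup_image _ _ _ (fun k => B i k + mp_pow B n k j)). Qed.

Lemma mp_star_ge0 i : 0 <= mp_star B i i.
Proof. by apply: le_trans (mp_pow_star 0 i i); rewrite /= /mp_id eqxx. Qed.

Lemma mp_mul_star i k j : B i k + mp_star B k j <= mp_star B i j.
Proof.
apply: ereal_sup_addl_le (Boo i k) _ => _ [n _ <-].
exact: le_trans (mp_mul_pow n i k j) (mp_pow_star _ _ _).
Qed.

Lemma le_mp_star i j : B i j <= mp_star B i j.
Proof.
apply: le_trans (mp_mul_star i j j).
by rewrite leeDl// mp_star_ge0.
Qed.

(** By induction [B w <= w] passes to every power, hence to the supremum. It serves for columns of
    the star, fixed points and modified potentials. *)
Lemma mp_star_super w i j : (forall k, w k != +oo) ->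
  (forall k l, B k l + w l <= w k) -> mp_star B i j + w j <= w i.
Proof.
move=> woo Bw; apply: ereal_sup_addr_le => // _ [n _ <-].
elim: n i => [|n IH] i /=.
  by rewrite /mp_id; case: eqP => [->|]; rewrite ?add0e// addNye leNye.
apply: ereal_sup_addr_le => // _ [k _ <-]; rewrite -addeA.
exact: le_trans (leeD2l _ (IH k)) (Bw i k).
Qed.

(** * The star under Property (T) *)

Context (TB : propertyT B).
Local Notation M := (mp_star B).

(** At [k = i] the tight map [M i k + M k j] would be [+oo], because [M i i >= 0]. *)
Lemma mp_star_neqy i j : M i j != +oo.
Proof.
apply/eqP => Mij; have [/(_ i)] := TB j i; rewrite Mij.
by have := mp_star_ge0 i; case: (M i i).
Qed.

Lemma mp_star_triangle i k j : M i k + M k j <= M i j.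
Proof.
by apply: (@mp_star_super (fun k => M k j)) => *;
  [exact: mp_star_neqy|exact: mp_mul_star].
Qed.

(* Property (T) makes the idempotent [M i i] finite, hence zero: no circuit has
   positive weight. *)
Lemma mp_star_diag i : M i i = 0.
Proof.
have := mp_star_triangle i i i; have := mp_star_ge0 i.
case: (M i i) (mp_star_neqy i i) => [r| |] // _.
rewrite -EFinD !lee_fin gerDl => r0 r0'.
by congr EFin; apply/eqP; rewrite eq_le r0 r0'.
Qed.

Lemma mp_star_cycle_le0 i j : M i j + M j i <= 0.
Proof. by rewrite -(mp_star_diag i) mp_star_triangle. Qed.

Lemma mp_star_tight i j : tight (fun k => M i k + M k j).
Proof. exact: TB. Qed.

Lemma weight_le_star x p : weight B x p <= M x (last x p).
Proof.
elim: p x => [|y p IH] x /=; first by rewrite weight_nil mp_star_diag.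
by rewrite weight_cons (le_trans _ (mp_mul_star x y _))// leeD2l.
Qed.

Lemma weight_arc_le x p a : a \in zip (x :: p) p ->
  weight B x p <= M x a.1 + (B a.1 a.2 + M a.2 (last x p)).
Proof.
elim: p x => [//|y p IH] x /=; rewrite inE weight_cons => /orP[/eqP -> /=|].
  by rewrite mp_star_diag add0e leeD2l// weight_le_star.
move=> /IH /(leeD2l (B x y)) /le_trans; apply.
by rewrite addeA leeD2r// mp_mul_star.
Qed.

(** The sum never exceeds [M k k = 0], so the condition says that an optimal return from [l] to [k]
    closes the arc into a circuit of weight zero. *)
Definition critical_link (k l : S) := 0 <= B k l + M l k.

Lemma null_circuit_link x p a : last x p = x -> weight B x p = 0 ->
  a \in zip (x :: p) p -> critical_link a.1 a.2.
Proof.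
move=> lx w0 /weight_arc_le; rewrite w0 lx addeC -addeA => /le_trans; apply.
by rewrite leeD2l// mp_star_triangle.
Qed.

(** Inserting the detour from [j] through [i] gives [M k j <= M k j + M j i + M i j <= M k i + M i
    j]. Columns [i] and [j] are thus proportional. *)
Lemma mp_star_class i j k : 0 <= M i j + M j i -> M k j = M k i + M i j.
Proof.
move=> ij0; apply/eqP; rewrite eq_le mp_star_triangle andbT.
have := leeD2l (M k j) ij0; rewrite adde0 => /le_trans; apply.
by rewrite (addeC (M i j)) addeA leeD2r// mp_star_triangle.
Qed.

(** The relation [0 <= M i j + M j i] is transitive by the triangle inequality, and [B <= M] makes
    every link an instance of it. *)
Lemma critical_link_path (e : rel S) i p :
  (forall k l, e k l -> critical_link k l) -> path e i p ->
  0 <= M i (last i p) + M (last i p) i.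
Proof.
move=> el; elim: p i => [|k p IH] i /=; first by rewrite mp_star_diag adde0.
move=> /andP[/el ik /IH].
have {}ik : 0 <= M i k + M k i by rewrite (le_trans ik)// leeD2r// le_mp_star.
set j := last k p => kj; apply: (le_trans (adde_ge0 ik kj)).
have -> : M i k + M k i + (M k j + M j k) = (M i k + M k j) + (M j k + M k i).
  by rewrite -!addeA; congr (_ + _); rewrite addeC -!addeA.
by rewrite leeD// mp_star_triangle.
Qed.

(* Let [X] be the set of nodes reachable from [i] along optimal arcs towards
   [j]; by tightness [X] is finite, and all the arcs leaving [X] are suboptimal
   by a uniform [e]. If [j] were not in [X], lowering the potential [M k j] by
   [e] on [X] would yield [M i j <= M i j - e]. *)
Lemma mp_star_attained i j : M i j != -oo ->
  exists p, [/\ path (Defs.arc B) i p, last i p = j & weight B i p = M i j].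
Proof.
move=> Mij; pose u k := M k j.
pose X := [set k | exists p, path (saturated B u) i p /\ last i p = k].
have [[p [ip pj]]|nXj] := pselect (X j).
  exists p; split => //; first exact: path_saturated_arc ip Mij.
  by have := weight_saturated ip; rewrite pj /u mp_star_diag adde0.
have Xi : X i by exists [::].
have Mfin : M i j = (fine (M i j))%:E.
  by rewrite fineK// fin_numE Mij mp_star_neqy.
have XM k : X k -> M i j <= M i k + M k j.
  move=> [p [ip <-]]; rewrite -[M i j](weight_saturated ip) leeD2r//.
  exact: weight_le_star.
have ufin k : X k -> u k \is a fin_num.
  move=> /XM; rewrite fin_numE mp_star_neqy andbT; apply: contraTneq => uk.
  by rewrite -/(u k) uk addeNy -ltNge Mfin ltNyr.
have [|||e e0 He] := @finite_uniform_gap R S X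
    (fun k e => forall l, ~ X l -> B k l + u l <= u k - e%:E).
- have [_ /(_ (fine (M i j)))] := mp_star_tight i j.
  by apply: sub_finite_set => k /XM; rewrite -Mfin.
- move=> k e e' ee' H l /H /le_trans; apply.
  by rewrite leeD2l// leeN2 lee_fin.
- move=> k Xk; have tk : tight (fun l => B k l + u l).
    by apply: tight_le (mp_star_tight k j) => l; rewrite leeD2r// le_mp_star.
  have uk := fineK (ufin k Xk).
  have [l nXl|e e0 He] := @tight_gap R S _ (~` X) (fine (u k)) tk.
    rewrite uk lt_neqAle mp_mul_star andbT; apply/negP => kl.
    apply: nXl; have [p [ip pk]] := Xk.
    by exists (rcons p l); rewrite rcons_path last_rcons ip pk.
  by exists e => // l /He; rewrite EFinB uk.
pose w k := if `[< X k >] then u k - e%:E else u k.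
have := @mp_star_super w i j.
rewrite /w (asboolF nXj) (asboolT Xi) /u mp_star_diag adde0 => Mw.
suff : M i j <= M i j - e%:E by rewrite Mfin lee_fin lerBrDr gerDl leNgt e0.
apply: Mw => [k|k l].
  case: ifP => _; last exact: mp_star_neqy.
  by apply: adde_neqy => //; exact: mp_star_neqy.
case: (asboolP (X k)) => [Xk|nXk]; case: (asboolP (X l)) => [Xl|nXl].
- by rewrite addeA leeD2r// mp_mul_star.
- exact: He.
- apply: le_trans (mp_mul_star k l j); rewrite leeD2l//.
  by rewrite -[leRHS]adde0 leeD2l// oppe_le0 lee_fin ltW.
- exact: mp_mul_star.
Qed.

Lemma mp_star_cycle_circuit i j : 0 <= M i j + M j i -> exists p q,
  [/\ path (Defs.arc B) i (p ++ q), last i p = j, last j q = i &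
      weight B i (p ++ q) = 0].
Proof.
move=> ij0; have [Mij Mji] : M i j != -oo /\ M j i != -oo.
  by move: ij0; case: (M i j) => [a| |]; case: (M j i).
have [p [ip pj wp]] := mp_star_attained Mij.
have [q [jq qi wq]] := mp_star_attained Mji.
exists p, q; split => //; first by rewrite cat_path ip pj.
by rewrite weight_cat pj wp wq; apply/eqP; rewrite eq_le mp_star_cycle_le0.
Qed.

(** * Tight fixed points and critical columns *)

Definition tight_fixed : set (S -> \bar R) :=
  [set u | [/\ forall i, u i != +oo, mx_tight M u
             & forall i, mp_act B u i = u i]].

Definition null_node (j : S) : Prop :=
  exists x p, [/\ circuit B x p, weight B x p = 0 & j \in x :: p].

Lemma null_node_link j : null_node j -> exists l, critical_link j l.
Proof.
move=> [x [p [[xp p0 px] w0 jp]]].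
have [l jl] := circuit_out_arc p0 px jp.
by exists l; have := null_circuit_link px w0 jl.
Qed.

Lemma tight_fixed_star_le u i j : tight_fixed u -> M i j + u j <= u i.
Proof.
move=> [uoo _ ue]; apply: mp_star_super => // k l.
by rewrite -[leRHS]ue le_mp_act.
Qed.

Lemma tight_fixed_saturated u i : tight_fixed u -> u i != -oo ->
  exists k, saturated B u i k.
Proof.
move=> uT ui; have [uoo ut ue] := uT.
have ti : tight (fun l => B i l + u l).
  by apply: tight_le (ut i) => l; rewrite leeD2r// le_mp_star.
have [||k _ ik] := @tight_sup_attained R S _ [set: S] (u i) ti.
- by rewrite fin_numE ui uoo.
- by rewrite -[leLHS]ue.
by exists k; rewrite /saturated eq_le ik andbT -[leRHS]ue le_mp_act.
Qed.

(* Following optimal arcs from [i] stays in a finite set by tightness, so it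
   closes up into a circuit of weight zero. *)
Lemma tight_fixed_null_node u i : tight_fixed u -> u i != -oo ->
  exists2 x, null_node x & u i = M i x + u x.
Proof.
move=> uT ui; have [uoo ut ue] := uT.
have /choice[f fP] : forall k, exists l, u k != -oo -> saturated B u k l.
  move=> k; have [_|uk] := eqVneq (u k) -oo; first by exists k.
  by have [l] := tight_fixed_saturated uT uk; exists l.
have fNy k : u k != -oo -> u (f k) != -oo.
  move=> uk; apply: contraNneq (uk) => ufk.
  by rewrite -(eqP (fP k uk)) ufk addeNy.
have itP t : u (iter t f i) != -oo /\ u i <= M i (iter t f i) + u (iter t f i).
  elim: t => [|t [ut0 uit]] /=; first by rewrite mp_star_diag add0e.
  split; first exact: fNy.
  apply: le_trans uit _; rewrite -[u (iter t f i)](eqP (fP _ ut0)) addeA leeD2r//.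
  exact: le_trans (leeD2l _ (le_mp_star _ _)) (mp_star_triangle _ _ _).
have [s [t [st its]]] : exists s t, (s < t)%N /\ iter s f i = iter t f i.
  apply: contrapT => H; apply: infinite_nat.
  have [_ /(_ (fine (u i)))] := ut i; rewrite fineK ?fin_numE ?ui ?uoo// => fin.
  have inj s t : iter s f i = iter t f i -> s = t.
    move=> its; apply: contrapT => /eqP; rewrite neq_ltn => st.
    by apply: H; move: st => /orP[] st; [exists s, t|exists t, s].
  have := @finite_preimage _ _ _ (fun t => iter t f i) (in2W inj) fin.
  by apply: sub_finite_set => t _; exact: (itP t).2.
set x := iter s f i; exists x; last first.
  apply/eqP; rewrite eq_le (itP s).2/=; exact: tight_fixed_star_le.
have sat_path n y : u y != -oo -> path (saturated B u) y (traject f (f y) n).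
  elim: n y => [//|n IH] y uy /=.
  by rewrite fP//= IH// fNy.
have xp := sat_path (t - s)%N x (itP s).1.
have lx : last x (traject f (f x) (t - s)) = x.
  by rewrite last_traject -iterD subnK// ltnW.
exists x, (traject f (f x) (t - s)); split; last exact: mem_head.
- split => //; first exact: path_saturated_arc xp (itP s).1.
  by rewrite size_traject subn_gt0.
- have := weight_saturated xp; rewrite lx.
  have : u x \is a fin_num by rewrite fin_numE (itP s).1 uoo.
  case: (u x) => // r _; case: (weight _ _ _) => // w /eqP.
  by rewrite -EFinD eqe -subr_eq0 addrK => /eqP ->.
Qed.

(** [B M <= M] always holds, and each term [n.+1] of the star is a [B]-step followed by a smaller
    power. Only the identity term needs [j] critical: a link out of [j] recovers its value [0]. *)
Lemma tight_fixed_column j : null_node j -> tight_fixed (fun i => M i j).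
Proof.
move=> /null_node_link[l jl]; split=> [i||i]; first exact: mp_star_neqy.
  exact: TB.
apply/eqP; rewrite eq_le; apply/andP; split.
  by apply: mp_act_le => k; exact: mp_mul_star.
apply: ge_ereal_sup_image => -[|n] _ /=.
  rewrite /mp_id; case: eqP => [->|_]; last exact: leNye.
  exact: le_trans jl (le_mp_act _ _ _).
apply: ge_ereal_sup_image => k _.
apply: le_trans (le_mp_act _ i k).
by rewrite leeD2l// mp_pow_star.
Qed.

(** The fixed-point equation survives because each column kept is a fixed point, and tightness is
    inherited from [u], which dominates. So terms can be deleted from a decomposition of [u]. *)
Lemma tight_fixed_sup u (D : set S) : tight_fixed u -> D `<=` null_node ->
  tight_fixed (fun i => ereal_sup [set M i j + u j | j in D]).
Proof.
move=> uT Dnull; have [uoo ut ue] := uT.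
set w := fun i => _.
have wu i : w i <= u i.
  by apply: ge_ereal_sup_image => j _; exact: tight_fixed_star_le.
have le_w i j : D j -> M i j + u j <= w i.
  by move=> Dj; apply: (@le_ereal_sup_image R S D (fun j => M i j + u j)).
split=> [i|i|i].
- by move: (wu i) (uoo i); case: (u i) => [r| |] //; case: (w i).
- by apply: tight_le (ut i) => j; rewrite leeD2l.
apply/eqP; rewrite eq_le; apply/andP; split.
  apply: mp_act_le => k; apply: ereal_sup_addl_le => // _ [j Dj <-].
  by apply: le_trans (le_w i j Dj); rewrite addeA leeD2r// mp_mul_star.
apply: ge_ereal_sup_image => j Dj.
have [_ _ je] := tight_fixed_column (Dnull j Dj).
rewrite -[M i j]je; apply: ereal_sup_addr_le => // _ [k _ <-].
by apply: le_trans (le_mp_act w i k); rewrite -addeA leeD2l// le_w.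
Qed.

Lemma tight_fixed_scale a u : tight_fixed u -> tight_fixed (fun i => a%:E + u i).
Proof.
move=> [uoo ut ue]; split=> [i|i|i]; first exact: adde_neqy.
- have := @tightD _ _ a%:E _ isT (ut i).
  by apply: tight_le => j; rewrite addeCA.
apply/eqP; rewrite eq_le; apply/andP; split.
  apply: mp_act_le => k; rewrite addeCA leeD2l// -[leRHS]ue; exact: le_mp_act.
rewrite -[u i]ue; apply: ereal_sup_addl_le => // _ [k _ <-].
by rewrite addeCA; exact: (le_mp_act (fun i => a%:E + u i)).
Qed.

(** * Extremal generators *)

Lemma extremal_generator_column a j : null_node j ->
  extremal_generator tight_fixed (fun i => a%:E + M i j).
Proof.
move=> jn; split; first exact/tight_fixed_scale/tight_fixed_column.
  by exists j; rewrite mp_star_diag adde0.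
(* By symmetry [u] may be taken larger at [j]; there it equals [a], and [M i j + u j <= u i] spreads
   this to every [i]. *)
suff H u v : tight_fixed u -> (fun i => a%:E + M i j) = (fun i => maxe (u i) (v i)) ->
    v j <= u j -> (fun i => a%:E + M i j) = u.
  move=> u v uT vT uv; have [vu|/ltW vu] := leP (v j) (u j); [left|right].
    exact: H uT uv vu.
  by apply: (H v u) => //; rewrite uv; apply/funext => i; exact: maxC.
move=> uT uvE vuj; have uv i := congr1 (@^~ i) uvE; rewrite /= in uv; apply/funext => i.
apply/eqP; rewrite eq_le; apply/andP; split; last by rewrite uv le_max lexx.
have -> : a%:E = u j by rewrite -(max_l vuj) -uv mp_star_diag adde0.
by rewrite addeC tight_fixed_star_le.
Qed.

Lemma extremal_generator_is_column u : extremal_generator tight_fixed u ->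
  exists (a : R) j, null_node j /\ u = (fun i => a%:E + M i j).
Proof.
move=> [uT [i0 ui0] uext]; have [uoo ut ue] := uT; apply: contrapT => ncol.
have ufin : u i0 \is a fin_num by rewrite fin_numE ui0 uoo.
pose w D := fun i => ereal_sup [set M i j + u j | j in D].
have le_w (D : set S) i j : D j -> M i j + u j <= w D i.
  by move=> Dj; apply: (@le_ereal_sup_image R S D (fun j => M i j + u j)).
(* By tightness [r] lists the finitely many [j] whose term [M i0 j + u j] reaches [u i0]. *)
have [_ /(_ (fine (u i0)))] := ut i0; rewrite fineK// => /finite_seqP[r rE].
have : u = w (null_node `\` [set` r]).
  elim: r {rE} => [|j r IH].
    apply/funext => i; apply/eqP; rewrite eq_le; apply/andP; split.
      have [->|ui] := eqVneq (u i) -oo; first exact: leNye.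
      have [j jn ->] := tight_fixed_null_node uT ui.
      by apply: le_w; split.
    by apply: ge_ereal_sup_image => j _; exact: tight_fixed_star_le.
  set D := _ `\` _ in IH; have Dn : D `<=` null_node by move=> k [].
  set D' := _ `\` _; have D'n : D' `<=` null_node by move=> k [].
  have [Dj|nDj] := pselect (D j); last first.
    rewrite IH; congr w; apply/seteqP; split=> k [kn kr]; split => //=.
      by rewrite inE => /orP[/eqP kj|]//; apply: nDj; rewrite -kj.
    by move=> k'r; apply: kr; rewrite /= inE k'r orbT.
  have jn : [set j] `<=` null_node by move=> _ ->; exact: Dn.
  (* [u] is the maximum of the term of [j] and of the terms left in [D'], so extremality keeps one
     of the two. *)
  have := uext _ _ (tight_fixed_sup uT jn) (tight_fixed_sup uT D'n).
  rewrite -/(w D'); case => // [|uj].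
    apply/funext => i; rewrite image_set1 ereal_sup1.
    apply/eqP; rewrite eq_le; apply/andP; split; last first.
      rewrite ge_max tight_fixed_star_le//=.
      by apply: ge_ereal_sup_image => k _; exact: tight_fixed_star_le.
    rewrite [leLHS](congr1 (@^~ i) IH); apply: ge_ereal_sup_image => k Dk.
    rewrite le_max; have [->|kj] := eqVneq k j; first by rewrite lexx.
    apply/orP; right; apply: le_w; split; first exact: Dn.
    by rewrite /= inE (negbTE kj)/= => kr; case: Dk.
  (* Here the term of [j] alone is [u], which makes [u] a multiple of a critical column, against
     [ncol]. *)
  have {}uj i : u i = M i j + u j.
    by rewrite [LHS](congr1 (@^~ i) uj) image_set1 ereal_sup1.
  have ujfin : u j \is a fin_num.
    rewrite fin_numE uoo andbT; apply: contra ui0 => /eqP ujN.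
    by rewrite uj ujN addeNy.
  exfalso; apply: ncol; exists (fine (u j)), j; split; first exact: Dn.
  by apply/funext => i; rewrite fineK// addeC.
(* Every term reaching [u i0] has been deleted, yet by tightness one of the remaining terms attains
   [u i0]. *)
move=> /(congr1 (@^~ i0)) uw.
have [|j [jn jr] uj] := tight_sup_attained (ut i0) ufin (D := null_node `\` [set` r]).
  by rewrite -[ereal_sup _]uw.
by apply: jr; rewrite -rE.
Qed.

(** * Spanning families of columns *)

Lemma spanning_transversal (J : set S) : J `<=` null_node ->
  (forall j, null_node j -> exists2 k, J k & 0 <= M k j + M j k) ->
  spanning_family tight_fixed J (fun j i => M i j).
Proof.
move=> Jn Jrep; split=> [k Jk|u uT]; first exact/tight_fixed_column/Jn.
(* Column [k] gets the coefficient [u k]. The term of a critical [j] is absorbed by that of its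
   representative [k], as [M i j = M i k + M k j] and [M k j + u j <= u k]. *)
have [uoo _ _] := uT; exists u; split=> // i.
apply/eqP; rewrite eq_le; apply/andP; split; last first.
  by apply: ge_ereal_sup_image => j _; rewrite addeC tight_fixed_star_le.
have [->|ui] := eqVneq (u i) -oo; first exact: leNye.
have [j jn ->] := tight_fixed_null_node uT ui.
have [k Jk kj] := Jrep j jn.
apply: le_trans (@le_ereal_sup_image R S J (fun k => u k + M i k) k Jk).
rewrite (mp_star_class i kj) -addeA addeC leeD2r//.
exact: tight_fixed_star_le.
Qed.

(** Row [k] of the decomposition of column [j] gives [nu k <= M k j]; row [j] then bounds
    [M j j = 0] by the supremum of [M j k + M k j] over [J], attained by tightness. *)
Lemma spanning_meets_class (J : set S) j : null_node j ->
  spanning_family tight_fixed J (fun j i => M i j) ->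
  exists2 k, J k & 0 <= M j k + M k j.
Proof.
move=> jn [Jn /(_ _ (tight_fixed_column jn)) [nu [nuoo nuE]]].
have nu_le k : J k -> nu k <= M k j.
  move=> Jk; rewrite nuE -[leLHS]adde0 -(mp_star_diag k).
  exact: (@le_ereal_sup_image R S J (fun l => nu l + M k l)).
have [||k Jk kj] := @tight_sup_attained R S _ J 0 (mp_star_tight j j) => //.
  rewrite -[leLHS](mp_star_diag j) nuE; apply: ge_ereal_sup_image => k Jk.
  apply: le_trans (@le_ereal_sup_image R S J (fun k => M j k + M k j) k Jk).
  by rewrite addeC leeD2l// nu_le.
by exists k.
Qed.

End Star.

(** * From [A] to its normalized matrix *)

Section Normalization.
Context {R : realType} {S : choiceType} {A : S -> S -> \bar R}.
Context (Aoo : forall i j, A i j != +oo).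
Context (rho_fin : max_circuit_mean A \is a fin_num).
Local Notation rho := (max_circuit_mean A).
Local Notation B := (normalized A).

Lemma normalizedK i j : A i j = B i j + rho.
Proof. by rewrite /normalized subeK. Qed.

Lemma normalized_neqy i j : B i j != +oo.
Proof.
rewrite /normalized; apply: adde_neqy => //.
by move: rho_fin; case: rho.
Qed.

Lemma arc_normalized : Defs.arc B = Defs.arc A.
Proof.
apply/funext => i; apply/funext => j; rewrite /Defs.arc /normalized.
by move: rho_fin; case: rho => // r _; case: (A i j).
Qed.

Lemma weight_normalized x p : weight A x p = weight B x p + (size p)%:R%:E * rho.
Proof.
elim: p x => [|y p IH] x; first by rewrite !weight_nil mul0e adde0.
rewrite !weight_cons IH normalizedK; move: (B x y) (weight B y p) => b w.
rewrite -!addeA; congr (_ + _); rewrite addeCA; congr (_ + _).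
rewrite -(fineK rho_fin) -!EFinM -EFinD; congr EFin.
by rewrite /= -[in RHS]addn1 natrD mulrDl mul1r addrC.
Qed.

Lemma circuit_normalized x p : circuit B x p <-> circuit A x p.
Proof. by rewrite /circuit arc_normalized. Qed.

(** Subtracting [rho] from every arc lowers each mean by [rho]; an infinite weight is excluded
    because [rho] is finite. *)
Lemma critical_circuitE x p :
  critical_circuit A x p <-> circuit B x p /\ weight B x p = 0.
Proof.
split=> [[cA mA]|[/circuit_normalized cA w0]]; split => //; have [_ p0 _] := cA.
- exact/circuit_normalized.
- have n0 : ((size p)%:R != 0 :> R)%R by rewrite pnatr_eq0 -lt0n.
  move: mA; rewrite /mean_weight weight_normalized -(fineK rho_fin).
  case: (weight B x p) => [w| |].
  + rewrite -!EFinM => -[]; rewrite mulrDl mulrAC divff// mul1r.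
    by move=> /eqP; rewrite -subr_eq0 addrK mulf_eq0 invr_eq0 (negbTE n0) orbF => /eqP ->.
  + by rewrite addye// gt0_mulye// lte_fin invr_gt0 ltr0n.
  + by rewrite addNye gt0_mulNye// lte_fin invr_gt0 ltr0n.
- rewrite /mean_weight weight_normalized w0 add0e -(fineK rho_fin) -!EFinM.
  by rewrite mulrAC divff ?mul1r// pnatr_eq0 -lt0n.
Qed.

Lemma critical_nodeE j : critical_node A j <-> null_node (B := B) j.
Proof.
split=> [[x [p [/critical_circuitE[]]]]|[x [p [cx w0 jp]]]].
  by exists x, p.
by exists x, p; split => //; apply/critical_circuitE.
Qed.

Lemma tight_eigenvectorsE : tight_eigenvectors A = tight_fixed (B := B).
Proof.
have rhoy : rho != +oo by move: rho_fin; case: rho.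
have actE u i : mp_act A u i = rho + mp_act B u i.
  apply/eqP; rewrite eq_le; apply/andP; split.
    apply: mp_act_le => k; rewrite normalizedK [_ + rho]addeC -addeA.
    by rewrite leeD2l// le_mp_act.
  apply: ereal_sup_addl_le => // _ [k _ <-].
  by rewrite addeA [rho + _]addeC -normalizedK le_mp_act.
apply/seteqP; split=> u [uoo ut ue]; split => // i.
  have /(congr1 (fun a => a - rho)) := ue i.
  by rewrite actE ![rho + _]addeC !addeK.
by rewrite actE ue.
Qed.

Context (TB : propertyT B).
Local Notation M := (mp_star B).

Lemma critical_arc_link i j : critical_arc A i j -> critical_link (B := B) i j.
Proof.
move=> [x [p [/critical_circuitE[[_ _ px] w0] ij]]].
exact: (null_circuit_link normalized_neqy TB px w0 ij).
Qed.

Lemma critical_reach_star i j : critical_reach A i j -> 0 <= M i j + M j i.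
Proof.
move=> [p [ip <-]].
apply: (critical_link_path normalized_neqy TB _ ip).
by move=> k l /asboolP; exact: critical_arc_link.
Qed.

Lemma star_critical_reach i j : 0 <= M i j + M j i -> critical_reach A i j.
Proof.
have [<- _|ij] := eqVneq i j; first by exists [::].
move=> /(mp_star_cycle_circuit normalized_neqy TB)[p [q [ip pj qi w0]]].
(* The circuit [p ++ q] of weight zero is critical, hence so is each arc of [p]; [i] and [j] being
   distinct makes it nonempty. *)
exists p; split => //; apply: path_zip => -[k l] kl; apply/asboolP.
exists i, (p ++ q); split; last by rewrite zip_path_cat mem_cat kl.
apply/critical_circuitE; split => //; split => //; last by rewrite last_cat pj.
by case: p pj {ip w0 kl} => //= ij'; rewrite ij' eqxx in ij.
Qed.

(** For a critical [i] this is its critical class, with mutual reachability traded for a condition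
    on weights. *)
Definition star_class (i : S) : set S :=
  [set j | critical_node A j /\ 0 <= M i j + M j i].

Lemma critical_classE C :
  critical_class A C <-> exists2 i, critical_node A i & C = star_class i.
Proof.
have E i : star_class i =
    [set j | critical_node A j /\ critical_reach A i j /\ critical_reach A j i].
  apply/seteqP; split=> j [jc H]; split => //.
    by split; apply: star_critical_reach => //; rewrite addeC.
  by apply: critical_reach_star; case: H.
by split=> [[i [ic ->]]|[i ic ->]]; exists i; rewrite ?E.
Qed.

End Normalization.

Theorem theorem6p5 (R : realType) (S : choiceType) (A : S -> S -> \bar R) :
  infinite_set [set: S] ->
  (forall i j, A i j != +oo) ->
  max_circuit_mean A \is a fin_num ->
  propertyT (normalized A) ->
  (forall xi : S -> \bar R,
     extremal_generator (tight_eigenvectors A) xi <->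
     exists (alpha : R) (j : S), critical_node A j /\
       xi = (fun i => alpha%:E + mp_star (normalized A) i j)) /\
  (forall J : set S, critical_transversal A J ->
     minimal_spanning_family (tight_eigenvectors A) J
       (fun j i => mp_star (normalized A) i j)).
Proof.
move=> _ Aoo rho_fin TB; have Boo := normalized_neqy Aoo rho_fin.
rewrite (tight_eigenvectorsE rho_fin); split=> [xi|J [Jc Jclass]].
  split=> [/(extremal_generator_is_column Boo TB)|].
    by move=> [a [j [/(critical_nodeE rho_fin) jn ->]]]; exists a, j.
  move=> [a [j [/(critical_nodeE rho_fin) jn ->]]].
  exact: extremal_generator_column.
have classP j : critical_node A j -> exists! k, star_class (A := A) j k /\ J k.
  by move=> jc; apply: Jclass; apply/(critical_classE Aoo rho_fin TB); exists j.
split.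
  apply: spanning_transversal => // [j /Jc|j].
    by move/(critical_nodeE rho_fin).
  move=> /(critical_nodeE rho_fin) /classP[k [[[kc jk] Jk] _]].
  by exists k => //; rewrite addeC.
(* A spanning [J'] meets the class of each [j] in [J], where [j] is the only element of [J]; so [J]
   is included in [J']. *)
move=> J' [J'J nJJ'] J'span; apply: nJJ' => j Jj.
have jc := Jc j Jj.
have jn : null_node (B := normalized A) j by apply/critical_nodeE.
have [k J'k jk] := spanning_meets_class Boo TB jn J'span.
have [l [_ l_uniq]] := classP j jc.
suff -> : j = k by [].
rewrite -(l_uniq j); last first.
  by split => //; split => //; rewrite (mp_star_diag Boo TB) adde0.
by apply: l_uniq; split; [split => //; exact/Jc/J'J|exact: J'J].
Qed.
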